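(* Consider a non-smooth problem in the class $\mathcal{NSP}(g,\sigma_f)$ and let $\{(z_{k-1},x_k,g_k,\hat x_k)\}_{k\ge 0}$ be generated by Method N with $\lambda_k=(k+1)/2$ for $k\ge0$ and $\beta_k=0$ for all $k\ge-1$. Assume that $\sigma_f>0$ and $\sup_{k\ge0}\|g_k\|_*\le M_f<+\infty$. Then, with the classical method, $$\max\Big\{f(\hat x_k)-f(x^* ),\ \min_{0\le i\le k}f(x_i)-f(x^* )\Big\}+\sigma_f\xi(x_{k+1},x^* )\le\frac{2M_f^2}{\sigma_d\sigma_f(k+4)},\qquad\forall k\ge0,$$ and, with the modified method, $$f(\hat x_k)-f(x^* )+\sigma_f\xi(z_k,x^* )\le\frac{2M_f^2}{\sigma_d\sigma_f}\cdot\frac{k+\log k+3/2}{(k+1)(k+2)}=O\left(\frac{M_f^2}{\sigma_d\sigma_fk}\right),\qquad\forall k\ge1.$$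
   Context: Setting. $E$ is a finite-dimensional real normed space with norm $\|\cdot\|$; $E^*$ is its dual, with pairing $\langle s,x\rangle$ and dual norm $\|s\|_*=\max_{\|x\|\le 1}\langle s,x\rangle$. $Q\subset E$ is a closed convex set and $f:E\to\mathbb R\cup\{+\infty\}$ is a lower-semicontinuous (lsc) convex function with $Q\subset \mathrm{dom} f$. The problem $\min_{x\in Q}f(x)$ is assumed to have an optimal solution; $x^*\in Q$ denotes one. A prox-function $d:E\to\mathbb R\cup\{+\infty\}$ is fixed: $d$ is nonnegative, continuously differentiable and strongly convex on $Q$ ($Q\subset\mathrm{dom}\,d$) with constant $\sigma_d>0$ with respect to $\|\cdot\|$, and $d(x_0)=\min_{x\in Q}d(x)=0$ for its unique minimizer $x_0\in Q$. For $x,y\in Q$: $l_d(y;x):=d(y)+\langle\nabla d(y),x-y\rangle$ and $\xi(y,x):=d(x)-l_d(y;x)$ (Bregman distance). For an lsc convex $\psi:E\to\mathbb R\cup\{+\infty\}$ with $Q\subset\mathrm{dom}\,\psi$, $\sigma(\psi):=\{\tau\ge0:\psi(x)-\tau d(x)\text{ is an lsc convex function on }Q\}$. Class $\mathcal{NSP}(g,\sigma_f)$: problems $\min_{x\in Q}f(x)$ for which a subgradient mapping $g(x)\in\partial f(x)$, $x\in Q$, and a number $\sigma_f\in\sigma(f)$ are given. One sets $m_f(y;x):=f(y)+\langle g(y),x-y\rangle+\sigma_f\xi(y,x)$. It is assumed that $\min_{x\in Q}\{\langle s,x\rangle+\beta d(x)\}$ is solvable for every $s\in E^*$, $\beta>0$.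 Parameters. Weight parameters $\lambda_k>0$ ($k\ge0$); scaling parameters $\beta_k\ge0$ ($k\ge-1$), nondecreasing in $k$. $S_k:=\sum_{i=0}^k\lambda_i$, $S_{-1}:=0$. Property 1 for a sequence of functions $\{\varphi_k(x)\}_{k\ge-1}$ (associated with $\{\lambda_k\},\{\beta_k\}$, test points $\{x_k\}_{k\ge0}$), with $z_k:=\mathrm{argmin}_{x\in Q}\varphi_k(x)$ (minimizers are assumed to exist): (A1) $\varphi_{-1}(z_{-1})=0$ and $z_{-1}=x_0$. (A2) For all $k\ge-1$, $x\in Q$: $\varphi_{k+1}(x)\ge\varphi_k(z_k)+\lambda_{k+1}m_f(x_{k+1};x)+\beta_{k+1}d(x)-\beta_kl_d(z_k;x)+S_k\sigma_f\xi(z_k,x)$. (A3) For all $k\ge-1$: $\varphi_k(z_k)\le\min_{x\in Q}\{\sum_{i=0}^k\lambda_im_f(x_i;x)+\beta_kl_d(z_k;x)-S_k\sigma_f\xi(z_k,x)\}$. Method N. Set $\hat x_0:=x_0:=z_{-1}:=\mathrm{argmin}_{x\in Q}d(x)$. For $k\ge0$ set $g_k:=g(x_k)\in\partial f(x_k)$ and, with a sequence $\{\varphi_k\}_{k\ge-1}$ satisfying Property 1, classical method: $x_{k+1}:=z_k:=\mathrm{argmin}_{x\in Q}\varphi_k(x)$, $\ \hat x_{k+1}:=\frac{S_k\hat x_k+\lambda_{k+1}z_k}{S_{k+1}}$; modified method: $z_k:=\mathrm{argmin}_{x\in Q}\varphi_k(x)$, $\ \hat x_{k+1}:=x_{k+1}:=\frac{S_k\hat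 x_k+\lambda_{k+1}z_k}{S_{k+1}}$. *)

(* Defs.v *)
From HB Require Import structures.
From mathcomp Require Import all_boot all_order all_algebra.
From mathcomp Require Import all_classical all_reals all_analysis.

Set Implicit Arguments.
Unset Strict Implicit.
Unset Printing Implicit Defensive.

Import Order.TTheory GRing.Theory Num.Theory.
Import numFieldNormedType.Exports.

Local Open Scope classical_set_scope.
Local Open Scope ring_scope.

(* Finite-dimensional real normed spaces; the dual space is [{scalar E}], since
   every linear functional on a finite-dimensional space is continuous. *)
#[short(type="finNormedModType")]
HB.structure Definition FinNormedModule (R : realType) :=
  {E of NormedModule R E & Vector R E}.

Section ConvexAnalysis.
Context {R : realType} {E : finNormedModType R}.
Implicit Types (Q : set E) (h f d psi : E -> \bar R) (s : E -> R).
Implicit Types (gd g : E -> {scalar E}) (x y z : E).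

Local Open Scope ereal_scope.

Definition dual_norm s : \bar R :=
  ereal_sup [set (s x)%:E | x in [set x | (`|x| <= 1)%R]].

Definition dom h : set E := [set x | h x < +oo].

(* No [-oo] value is assumed, so the right-hand side is never [oo - oo], and
   [0 * +oo = 0] makes the endpoints t = 0 and t = 1 harmless. *)
Definition econvex h : Prop := forall x y (t : R), (0 <= t <= 1)%R ->
  h (t *: x + (1 - t) *: y)%R <= t%:E * h x + (1 - t)%:E * h y.

Record lsc_convex h : Prop := LscConvex {
  lsc_convex_Nyinfty : forall x, -oo < h x;
  lsc_convex_lsc : lower_semicontinuous h;
  lsc_convex_convex : econvex h }.

Definition argmin Q h : set E :=
  [set z | Q z /\ forall x, Q x -> h z <= h x].

Definition subdifferential f x : set {scalar E} :=
  [set s : {scalar E} | forall y, f x + (s (y - x)%R)%:E <= f y].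

Local Open Scope ring_scope.

(* [gd] plays the role of the gradient of d on Q.  Only increments inside Q are
   considered, so Q may have empty interior; the number [gd y (x - y)], for x and
   y in Q, does not depend on the choice of [gd]. *)
Record C1_on Q d gd : Prop := C1On {
  C1_on_diff : forall y, Q y -> forall x,
    (fine (d x) - fine (d y) - gd y (x - y) : R^o)
      =o_(x \near within Q (nbhs y)) (x - y);
  C1_on_continuous : forall y, Q y ->
    dual_norm (gd x \- gd y) @[x --> within Q (nbhs y)] --> 0%E }.

Definition strongly_convex_on Q d (sd : R) : Prop :=
  forall x y (t : R), Q x -> Q y -> 0 <= t <= 1 ->
    fine (d (t *: x + (1 - t) *: y)) <=
      t * fine (d x) + (1 - t) * fine (d y)
      - sd / 2 * t * (1 - t) * `|x - y| ^+ 2.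

Record prox_function Q d gd (sd : R) (x0 : E) : Prop := ProxFunction {
  prox_Nyinfty : forall x, (-oo < d x)%E;
  prox_dom : Q `<=` dom d;
  prox_ge0 : forall x, Q x -> (0 <= d x)%E;
  prox_C1 : C1_on Q d gd;
  prox_modulus_gt0 : 0 < sd;
  prox_strongly_convex : strongly_convex_on Q d sd;
  prox_argmin : argmin Q d = [set x0];
  prox_min0 : d x0 = 0%E;
  prox_solvable : forall (s : {scalar E}) (b : R), 0 < b ->
    argmin Q (fun x => (s x)%:E + b%:E * d x)%E !=set0 }.

Definition ell d gd y x : R := fine (d y) + gd y (x - y).

Definition bregman d gd y x : R := fine (d x) - ell d gd y x.

(* The set sigma(psi) of convexity parameters of psi relative to d on Q. *)
Definition sigma_set Q d psi : set R :=
  [set tau : R | 0 <= tau /\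
    let h x := fine (psi x) - tau * fine (d x) in
    lower_semicontinuous (EFin \o h : subspace Q -> \bar R) /\
    convex_function Q h].

Record NSP Q d f g (sf : R) : Prop := NSPClass {
  NSP_closed : closed Q;
  NSP_convex : convex_set Q;
  NSP_lsc_convex : lsc_convex f;
  NSP_dom : Q `<=` dom f;
  NSP_subgradient : forall x, Q x -> subdifferential f x (g x);
  NSP_sigma : sigma_set Q d f sf }.

Definition model d gd f g (sf : R) y x : R :=
  fine (f y) + g y (x - y) + sf * bregman d gd y x.

(* [wsum lambda n] is S_(n-1) = lambda_0 + ... + lambda_(n-1), so that
   [wsum lambda 0] is S_(-1) = 0. *)
Definition wsum (lambda : nat -> R) (n : nat) : R := \sum_(i < n) lambda i.

(* Sequences whose index starts at -1 are shifted by one: [phi n], [beta n] and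
   [z n] stand for phi_(n-1), beta_(n-1) and z_(n-1); the sequences lambda and x
   are not shifted. *)
Record property1 Q d gd f g (sf : R) (lambda beta : nat -> R)
    (x : nat -> E) (x0 : E) (phi : nat -> E -> \bar R) (z : nat -> E) : Prop :=
  Property1 {
  property1_argmin : forall n, argmin Q (phi n) (z n);
  property1_A1 : phi 0 (z 0) = 0%E /\ z 0 = x0;
  property1_A2 : forall n y, Q y ->
    (phi n (z n) +
      (lambda n * model d gd f g sf (x n) y
       + beta n.+1 * fine (d y) - beta n * ell d gd (z n) y
       + wsum lambda n * sf * bregman d gd (z n) y)%:E <= phi n.+1 y)%E;
  property1_A3 : forall n,
    (phi n (z n) <= ereal_inf
      [set (\sum_(i < n) lambda i * model d gd f g sf (x i) y
            + beta n * ell d gd (z n) y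
            - wsum lambda n * sf * bregman d gd (z n) y)%R%:E | y in Q])%E }.

(* Part of Method N common to both variants; [z] is shifted as above. *)
Record methodN Q d gd f g (sf : R) (lambda beta : nat -> R) (x0 : E)
    (phi : nat -> E -> \bar R) (z x xhat : nat -> E) : Prop := MethodN {
  methodN_xhat0 : xhat 0 = x0;
  methodN_x0 : x 0 = x0;
  methodN_property1 : property1 Q d gd f g sf lambda beta x x0 phi z }.

Definition average (lambda : nat -> R) (z xhat : nat -> E) (k : nat) : E :=
  (wsum lambda k.+2)^-1 *:
    (wsum lambda k.+1 *: xhat k + lambda k.+1 *: z k.+1).

Definition classical_step (lambda : nat -> R) (z x xhat : nat -> E) : Prop :=
  forall k, x k.+1 = z k.+1 /\ xhat k.+1 = average lambda z xhat k.

Definition modified_step (lambda : nat -> R) (z x xhat : nat -> E) : Prop :=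
  forall k, x k.+1 = average lambda z xhat k /\ xhat k.+1 = x k.+1.

End ConvexAnalysis.

(* Main.v *)
(** Strong convexity and differentiability of d along segments of Q give
    xi(y,x) >= sigma_d/2 |x - y|^2, and sigma_f in sigma(f) gives m_f(y;x) <= f(x).
    Since every beta_k vanishes, (A2) at x = z_(k+1) bounds phi_(k+1)(z_(k+1))
    below by phi_k(z_k) plus a linearisation of f, and the linear term
    lambda <g, z_(k+1) - z_k> is absorbed by the Bregman distance at the price of an
    error lambda^2 M_f^2 / (2 sigma_d sigma_f S), with S = S_(k+1) for the classical
    method and S = S_k for the modified one.  Comparing the accumulated lower bound
    with (A3) at x* yields both rates; for lambda_k = (k+1)/2 the errors are, up to
    the factor M_f^2 / (2 sigma_d sigma_f), (i+1)/(i+2)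
    for the classical method and 1 + 1/i (1/2 for i = 0) for the modified one. *)
Require Import Defs.
From mathcomp Require Import all_boot all_order all_algebra.
From mathcomp Require Import all_classical all_reals all_analysis.
From mathcomp Require Import ring lra.
Import Order.TTheory GRing.Theory Num.Theory.
Import numFieldNormedType.Exports.
Local Open Scope classical_set_scope.
Local Open Scope ring_scope.

Set Implicit Arguments.
Unset Strict Implicit.
Unset Printing Implicit Defensive.

(** Stands in for letting a step size tend to 0 in a difference quotient. If [b < a], the witness
    [e = (a - b) / (1 + |c| + (a - b))] gives [e * c < a - b], whatever the sign of [c]. *)
Lemma ler_addgt0Ml (R : realFieldType) (a b c : R) :
  (forall e, 0 < e -> a <= b + e * c) -> a <= b.
Proof.
move=> H; rewrite leNgt; apply/negP => ba.
have c1_gt0 : 0 < 1 + `|c| + (a - b) by have := normr_ge0 c; lra.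
have e_gt0 : 0 < (a - b) / (1 + `|c| + (a - b)) by rewrite divr_gt0// subr_gt0.
have := H _ e_gt0.
rewrite -mulrAC -lerBlDl ler_pdivlMr//.
have := ler_norm c; nra.
Qed.

Lemma convex_setP (R : realType) (E : lmodType R) (Q : set E) x y (t : R) :
  convex_set Q -> Q x -> Q y -> 0 <= t <= 1 -> Q (t *: x + (1 - t) *: y).
Proof.
move=> cQ Qx Qy /andP[t0 t1].
by have /set_mem := cQ x y (Itv01 t0 t1) (mem_set Qx) (mem_set Qy).
Qed.

Lemma segmentB (R : pzRingType) (E : lmodType R) (x y : E) (t : R) :
  t *: x + (1 - t) *: y - y = t *: (x - y).
Proof.
by rewrite scalerBl scale1r -addrA [y - _ - y]addrAC subrr add0r -scalerBr.
Qed.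

Lemma NSP_fin_num (R : realType) (E : finNormedModType R) (Q : set E)
    (d f : E -> \bar R) (g : E -> {scalar E}) (sf : R) x :
  NSP Q d f g sf -> Q x -> f x = (fine (f x))%:E.
Proof.
move=> Pf Qx; rewrite fineK// fin_numElt.
by rewrite (lsc_convex_Nyinfty (NSP_lsc_convex Pf)) (NSP_dom Pf).
Qed.

(** * Bregman distance and model of f along segments of Q *)

Section ProxFunctions.
Context {R : realType} {E : finNormedModType R}.
Implicit Types (Q : set E) (f d : E -> \bar R) (gd g : E -> {scalar E}).

(** Differentiability is only available within Q, and convexity keeps the segment there. Since [t]
    is also at most [e], one parameter controls both the remainder and the terms quadratic in
    [t]. *)
Lemma C1_on_segment Q d gd x y (e : R) : C1_on Q d gd -> convex_set Q ->
  Q x -> Q y -> 0 < e -> exists2 t, 0 < t <= Num.min e 1 &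
    `|fine (d (t *: x + (1 - t) *: y)) - fine (d y) - t * gd y (x - y)|
      <= e * t.
Proof.
move=> [diff _] cQ Qx Qy e_gt0.
have n_gt0 : 0 < 1 + `|x - y| by rewrite ltr_pwDl.
have /funext/eqoP diffy := diff y Qy.
(* The little-o is used with constant [e / (1 + |x - y|)]; the added 1 covers the case x = y. *)
have /nbhs_ballP[r /= r_gt0 rP] := diffy _ (divr_gt0 e_gt0 n_gt0).
pose t := Num.min (Num.min e 1) (r / 2 / (1 + `|x - y|)).
have t_gt0 : 0 < t by rewrite !lt_min e_gt0 ltr01 !divr_gt0.
have t_le1 : t <= 1 by rewrite !ge_min lexx orbT.
exists t; first by rewrite t_gt0/= ge_min lexx.
have := rP (t *: x + (1 - t) *: y).
rewrite -ball_normE /= -normrN opprB segmentB linearZ/= normrZ gtr0_norm//.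
have tr : t * `|x - y| < r.
  have tr2 : t * (1 + `|x - y|) <= r / 2.
    by rewrite -ler_pdivlMr// ge_min lexx orbT.
  apply: le_lt_trans (_ : r / 2 < r); last by lra.
  by apply: le_trans tr2; rewrite ler_wpM2l ?(ltW t_gt0)// lerDr.
move=> /(_ tr (convex_setP cQ Qx Qy _)).
rewrite (ltW t_gt0) t_le1 => /(_ isT) /le_trans; apply.
rewrite [leLHS](_ : _ = e * t * (`|x - y| / (1 + `|x - y|))); last by ring.
by rewrite ger_pMr ?mulr_gt0// ler_pdivrMr// mul1r lerDr.
Qed.

Lemma bregman_ge Q d gd (sd : R) (x0 x y : E) : prox_function Q d gd sd x0 ->
  convex_set Q -> Q x -> Q y -> sd / 2 * `|x - y| ^+ 2 <= bregman d gd y x.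
Proof.
move=> Pd cQ Qx Qy.
(* The 1 pays for the remainder of the derivative; the other summand pays for the factor [1 - t] in
   strong convexity, as [t <= e]. *)
apply: (@ler_addgt0Ml _ _ _ (1 + sd / 2 * `|x - y| ^+ 2)) => e e_gt0.
have [t /andP[t_gt0]] := C1_on_segment (prox_C1 Pd) cQ Qx Qy e_gt0.
rewrite le_min => /andP[te t1].
rewrite ler_norml /bregman /ell => /andP[+ _].
have : 0 <= sd / 2 * `|x - y| ^+ 2.
  by rewrite mulr_ge0 ?exprn_ge0// divr_ge0// ltW// (prox_modulus_gt0 Pd).
have := prox_strongly_convex Pd Qx Qy.
move=> /(_ t); rewrite (ltW t_gt0) t1 => /(_ isT).
set du := fine (d _); set n2 := `|x - y| ^+ 2.
set q := _ / 2 * n2.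
rewrite (_ : sd / 2 * t * (1 - t) * n2 = t * (1 - t) * q);
  last by rewrite /q; ring.
move=> h1 h2 q_ge0; rewrite -(ler_pM2l t_gt0).
have : e * t * q >= t * t * q by rewrite ler_wpM2r// ler_wpM2r// ltW.
by nra.
Qed.

(** At a point u of the segment near y, combine the subgradient inequality from y, the convexity of
    [f - sf * d], and the expansion of d at y; dividing by [t] leaves the error [sf * e]. *)
Lemma model_le Q d gd f g (sd sf : R) (x0 x y : E) :
  prox_function Q d gd sd x0 -> NSP Q d f g sf -> Q x -> Q y ->
  model d gd f g sf y x <= fine (f x).
Proof.
move=> Pd Pf Qx Qy.
have cQ := NSP_convex Pf.
have [sf_ge0 [_ cf]] := NSP_sigma Pf.
apply: (@ler_addgt0Ml _ _ _ sf) => e e_gt0.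
have [t /andP[t_gt0]] := C1_on_segment (prox_C1 Pd) cQ Qx Qy e_gt0.
rewrite le_min => /andP[te t1].
rewrite ler_norml /model /bregman /ell => /andP[_].
have Qu : Q (t *: x + (1 - t) *: y).
  by apply: convex_setP => //; rewrite (ltW t_gt0).
set u := t *: x + _ in Qu *.
have : fine (f u) - sf * fine (d u) <=
    t * (fine (f x) - sf * fine (d x))
    + (1 - t) * (fine (f y) - sf * fine (d y)).
  exact: (cf (Itv01 (ltW t_gt0) t1) x y (mem_set Qx) (mem_set Qy)).
have := NSP_subgradient Pf Qy u.
rewrite (NSP_fin_num Pf Qy) (NSP_fin_num Pf Qu) -EFinD lee_fin segmentB linearZ/=.
move=> h1 h2 h3; rewrite -(ler_pM2l t_gt0).
have : sf * (fine (d u) - fine (d y) - t * gd y (x - y)) <= sf * (e * t).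
  by rewrite ler_wpM2l.
nra.
Qed.

End ProxFunctions.

Lemma dual_norm_ge (R : realType) (E : finNormedModType R) (s : {scalar E})
    (M : R) h : (dual_norm s <= M%:E)%E -> - (M * `|h|) <= s h.
Proof.
move=> sM; have [->|h0] := eqVneq h 0.
  by rewrite normr0 mulr0 oppr0 linear0.
have n_gt0 : 0 < `|h| by rewrite normr_gt0.
have : (s (- (`|h|^-1 *: h)) <= M).
  rewrite -lee_fin; apply: le_trans sM; apply: ereal_sup_ubound.
  exists (- (`|h|^-1 *: h)) => //=.
  by rewrite normrN normrZ normfV normr_id mulVf// gt_eqF.
by rewrite linearN linearZ/= lerNl ler_pdivlMl// mulrN mulrC.
Qed.

Lemma young_ge (R : realFieldType) (l M w c r : R) : 0 < w -> 0 < c ->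
  - (l ^+ 2 * M ^+ 2 / (2 * c) / w) <= - (l * (M * r)) + w * (c / 2 * r ^+ 2).
Proof.
move=> w_gt0 c_gt0; rewrite -subr_ge0.
rewrite (_ : _ - _ = (w * c * r - l * M) ^+ 2 / (2 * w * c)).
  by rewrite divr_ge0 ?sqr_ge0// !mulr_ge0// ltW.
by field; rewrite !gt_eqF.
Qed.

Lemma wsumS (R : realType) (lambda : nat -> R) n :
  wsum lambda n.+1 = wsum lambda n + lambda n.
Proof. exact: big_ord_recr. Qed.

(** * Estimates common to both variants of Method N *)

Section MethodN.
Context {R : realType} {E : finNormedModType R}
  (Q : set E) (f d : E -> \bar R) (gd g : E -> {scalar E})
  (sd sf M : R) (x0 xstar : E) (lambda beta : nat -> R)
  (phi : nat -> E -> \bar R) (z x xhat : nat -> E)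
  (Hd : prox_function Q d gd sd x0)
  (Hf : NSP Q d f g sf)
  (Hxstar : argmin Q f xstar)
  (lambda_gt0 : forall k, 0 < lambda k)
  (Hbeta : forall k, beta k = 0)
  (Hmethod : methodN Q d gd f g sf lambda beta x0 phi z x xhat)
  (sf_gt0 : 0 < sf)
  (HM : (ereal_sup [set dual_norm (g (x k)) | k in [set: nat]] <= M%:E)%E).

Local Notation W := (wsum lambda).
Local Notation err l w := (l ^+ 2 * M ^+ 2 / (2 * (sf * sd)) / w).

Let sfsd_gt0 : 0 < sf * sd.
Proof. by rewrite mulr_gt0// (prox_modulus_gt0 Hd). Qed.

Lemma wsum_gt0 n : 0 < W n.+1.
Proof.
elim: n => [|n IHn]; last by rewrite wsumS addr_gt0.
by rewrite wsumS /wsum big_ord0 add0r.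
Qed.

Let Qz n : Q (z n).
Proof. by case: (property1_argmin (methodN_property1 Hmethod) n). Qed.

Let Qx0 : Q x0.
Proof. by have [_ <-] := property1_A1 (methodN_property1 Hmethod). Qed.

Lemma phi_step n a : (a%:E <= phi n (z n))%E ->
  ((a + lambda n * model d gd f g sf (x n) (z n.+1)
    + W n * sf * bregman d gd (z n) (z n.+1))%:E <= phi n.+1 (z n.+1))%E.
Proof.
move=> aphi; apply: le_trans (property1_A2 (methodN_property1 Hmethod) n (Qz _)).
by rewrite !Hbeta !mul0r addr0 subr0 -addrA EFinD leeD2r.
Qed.

Lemma phi_le_opt n a : (forall i, Q (x i)) -> (a%:E <= phi n (z n))%E ->
  a + W n * sf * bregman d gd (z n) xstar <= W n * fine (f xstar).
Proof.
move=> Qx aphi; have [Qs _] := Hxstar.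
have := le_trans aphi (property1_A3 (methodN_property1 Hmethod) n).
move=> /le_trans/(_ (ereal_inf_lbound _)) => /(_ _ (ex_intro2 _ _ xstar Qs erefl)).
rewrite lee_fin Hbeta mul0r addr0 lerBrDr => /le_trans; apply.
rewrite /wsum mulr_suml; apply: ler_sum => i _.
by rewrite ler_wpM2l ?(ltW (lambda_gt0 _))// (model_le Hd Hf).
Qed.

(** The weight [w] stays free because the two variants have different multiples of the Bregman
    distance at their disposal. *)
Lemma subgradient_step_ge n w y u : 0 < w -> Q y -> Q u ->
  - err (lambda n) w <=
    lambda n * g (x n) (u - y) + w * (sf * bregman d gd y u).
Proof.
move=> w_gt0 Qy Qu.
apply: le_trans (young_ge (lambda n) M `|u - y| w_gt0 sfsd_gt0) _.
apply: lerD.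
  rewrite -mulrN ler_wpM2l ?(ltW (lambda_gt0 _))//.
  apply: dual_norm_ge; apply: le_trans HM; apply: ereal_sup_ubound.
  by exists n.
rewrite ler_wpM2l ?(ltW w_gt0)// -mulrA -mulrA ler_wpM2l ?(ltW sf_gt0)// mulrA.
exact: bregman_ge Hd (NSP_convex Hf) Qu Qy.
Qed.

Lemma average_segment k (t := W k.+1 / W k.+2) : 0 <= t <= 1 /\
  average lambda z xhat k = t *: xhat k + (1 - t) *: z k.+1.
Proof.
have W1 := wsum_gt0 k; have W2 := wsum_gt0 k.+1; split.
  rewrite divr_ge0 ?(ltW W1) ?(ltW W2)//= ler_pdivrMr// mul1r.
  by rewrite [leRHS]wsumS lerDl ltW.
rewrite /average scalerDr !scalerA mulrC; congr (_ + _ *: _).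
by rewrite /t [W k.+2]wsumS in W2 *; field; rewrite gt_eqF.
Qed.

(** * Classical method *)

Lemma classical_x_in k : classical_step lambda z x xhat -> Q (x k).
Proof.
by move=> Hc; case: k => [|k]; [rewrite (methodN_x0 Hmethod)|have [-> _] := Hc k].
Qed.

(** The test point is the previous minimizer ([x n = z n] in shifted indices), so the Bregman term
    of the model has the same base point as the accumulated one and raises its weight from [W n] to
    [W n.+1]. *)
Lemma classical_phi_ge n : classical_step lambda z x xhat ->
  ((\sum_(i < n) (lambda i * fine (f (x i)) - err (lambda i) (W i.+1)))%:E
     <= phi n (z n))%E.
Proof.
move=> Hc; have [A1 z0] := property1_A1 (methodN_property1 Hmethod).
elim: n => [|n IHn]; first by rewrite big_ord0 A1.
have xz : x n = z n.
  by case: n {IHn} => [|n]; [rewrite (methodN_x0 Hmethod)|case: (Hc n)].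
rewrite big_ord_recr/=; apply: le_trans (phi_step IHn).
rewrite lee_fin -[leRHS]addrA lerD2l /model {4 5}xz.
have := subgradient_step_ge n (wsum_gt0 n) (Qz n) (Qz n.+1).
rewrite xz wsumS; lra.
Qed.

(** Jensen's inequality: [xhat k] is the average of the test points with weights [lambda i], built
    up one two-point combination at a time. *)
Lemma classical_xhat_le k : classical_step lambda z x xhat ->
  Q (xhat k) /\
  W k.+1 * fine (f (xhat k)) <= \sum_(i < k.+1) lambda i * fine (f (x i)).
Proof.
move=> Hc; elim: k => [|k [Qk IHk]].
  rewrite (methodN_xhat0 Hmethod) big_ord1 (methodN_x0 Hmethod).
  by rewrite wsumS /wsum big_ord0 add0r.
have [xz ->] := Hc k; have [t01 ->] := average_segment k.
have Qk1 := convex_setP (NSP_convex Hf) Qk (Qz k.+1) t01.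
split=> //.
have := lsc_convex_convex (NSP_lsc_convex Hf) (xhat k) (z k.+1) t01.
rewrite (NSP_fin_num Hf Qk) (NSP_fin_num Hf (Qz _)) (NSP_fin_num Hf Qk1).
rewrite -!EFinM -EFinD lee_fin.
move: (fine (f (_ + _))) => v; rewrite -(ler_pM2l (wsum_gt0 k.+1)).
move=> /le_trans; apply; rewrite big_ord_recr/= xz.
rewrite [leLHS](_ : _ =
  W k.+1 * fine (f (xhat k)) + lambda k.+1 * fine (f (z k.+1))).
  exact: lerD.
have := wsum_gt0 k.+1; rewrite [W k.+2]wsumS => W2.
by field; rewrite gt_eqF.
Qed.

(** * Modified method *)

Lemma modified_xhat k : modified_step lambda z x xhat -> xhat k = x k.
Proof.
case: k => [|k] Hm; last by case: (Hm k).
by rewrite (methodN_xhat0 Hmethod) (methodN_x0 Hmethod).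
Qed.

Lemma modified_x_in k : modified_step lambda z x xhat -> Q (x k).
Proof.
move=> Hm; elim: k => [|k IHk]; first by rewrite (methodN_x0 Hmethod).
have [-> _] := Hm k; have [t01 ->] := average_segment k.
by apply: convex_setP (NSP_convex Hf) _ _ t01; rewrite // modified_xhat.
Qed.

(* The weights satisfy S_n (x_n - x_(n+1)) = lambda_(n+1) (x_(n+1) - z_n), so
   that linearising f at x_(n+1) produces the increment z_(n+1) - z_n. *)
Lemma modified_phi_ge n : modified_step lambda z x xhat ->
  ((W n.+1 * fine (f (x n)) - (err (lambda 0) (W 1) +
     \sum_(i < n) err (lambda i.+1) (W i.+1)))%:E <= phi n.+1 (z n.+1))%E.
Proof.
move=> Hm; have [A1 z0] := property1_A1 (methodN_property1 Hmethod).
elim: n => [|n IHn].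
  have := @phi_step 0 0; rewrite A1 => /(_ (lexx _)); apply: le_trans.
  (* At the first step the test point is still the minimizer, so the classical argument applies,
     with weight [W 1]. *)
  have xz : x 0 = z 0 by rewrite (methodN_x0 Hmethod).
  rewrite lee_fin big_ord0 /model {3 4}xz.
  have := subgradient_step_ge 0 (wsum_gt0 0) (Qz 0) (Qz 1).
  rewrite xz wsumS /wsum big_ord0; lra.
apply: le_trans (phi_step IHn).
rewrite lee_fin big_ord_recr/= /model.
(* The weight is S_n, without lambda_(n+1): the Bregman term of the model is based at [x n.+1]
   rather than [z n.+1], and is dropped as nonnegative. *)
have step := subgradient_step_ge n.+1 (wsum_gt0 n) (Qz n.+1) (Qz n.+2).
have Qn := modified_x_in n Hm; have Qn1 := modified_x_in n.+1 Hm.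
have xi_ge0 : 0 <= lambda n.+1 * (sf * bregman d gd (x n.+1) (z n.+2)).
  rewrite !mulr_ge0// ?(ltW (lambda_gt0 _)) ?(ltW sf_gt0)//.
  apply: le_trans (bregman_ge Hd (NSP_convex Hf) (Qz n.+2) Qn1).
  by rewrite mulr_ge0 ?exprn_ge0// divr_ge0// ltW// (prox_modulus_gt0 Hd).
(* Trades S_n f(x_n) for S_n f(x_(n+1)) plus a linear term, which [gE] turns into the missing part
   of the increment. *)
have := NSP_subgradient Hf Qn1 (x n).
rewrite (NSP_fin_num Hf Qn) (NSP_fin_num Hf Qn1) -EFinD lee_fin.
rewrite -(ler_pM2l (wsum_gt0 n)).
have xE : W n.+1 *: (x n - x n.+1) = lambda n.+1 *: (x n.+1 - z n.+1).
  apply/eqP; rewrite !scalerBr subr_eq addrAC -scalerDl [_ + W _]addrC -wsumS.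
  rewrite eq_sym subr_eq; have [-> _] := Hm n.
  by rewrite /average scalerA mulfV ?gt_eqF ?wsum_gt0// scale1r modified_xhat.
have gE : W n.+1 * g (x n.+1) (x n - x n.+1) =
    lambda n.+1 * g (x n.+1) (x n.+1 - z n.+1).
  by rewrite -!linearZ_LR xE.
have gD : g (x n.+1) (z n.+2 - z n.+1) =
    g (x n.+1) (z n.+2 - x n.+1) + g (x n.+1) (x n.+1 - z n.+1).
  by rewrite -linearD addrA subrK.
move: step; rewrite gD [W n.+2]wsumS [W n.+1 * (_ + _)]mulrDr gE; lra.
Qed.

End MethodN.

(** * Sums of errors and rates for lambda_k = (k+1)/2 *)

Lemma wsum_half (R : realType) (lambda : nat -> R) n :
  (forall k, lambda k = k.+1%:R / 2) ->
  wsum lambda n = n%:R * n.+1%:R / 4.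
Proof.
move=> Hl; elim: n => [|n IHn]; first by rewrite /wsum big_ord0 !mul0r.
by rewrite wsumS IHn Hl -!natr1; field.
Qed.

(** The bound has the factor (k+1)(k+2) of S_k, so that division by S_k leaves 4/(k+4). It is an
    equality at k = 0, and its increments dominate the summands. *)
Lemma sum_ratio_le (R : realFieldType) k :
  \sum_(i < k.+1) (i.+1%:R / i.+2%:R : R) <= k.+1%:R * k.+2%:R / (k + 4)%:R.
Proof.
elim: k => [|k IHk]; first by rewrite big_ord1 add0n/=; lra.
rewrite big_ord_recr/=; apply: le_trans (lerD IHk (lexx _)) _.
rewrite !addnS !addn0 -!natr1; have := ler0n R k; move: k%:R => n n_ge0.
rewrite -subr_ge0.
rewrite [leRHS](_ : _ = (n + 2) * (n + 1)
  / ((n + 3) * (n + 4) * (n + 5))).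
  by rewrite divr_ge0// !mulr_ge0//; lra.
by field; rewrite !gt_eqF//; lra.
Qed.

Lemma sum_harmonic_le (R : realType) k : (0 < k)%N ->
  \sum_(i < k) (i.+2%:R / i.+1%:R : R) <= k%:R + ln k%:R + 1.
Proof.
case: k => // k _; elim: k => [|k IHk].
  by rewrite big_ord1 ln1/=; lra.
rewrite big_ord_recr/=; apply: le_trans (lerD IHk (lexx _)) _.
have k1 : 0 < k.+1%:R :> R by rewrite ltr0n.
have k2 : 0 < k.+2%:R :> R by rewrite ltr0n.
(* Each summand is 1 + 1/(i+1); this inequality bounds the new harmonic term by the increment of the
   logarithm. *)
have : ln (1 - k.+2%:R^-1 : R) <= - k.+2%:R^-1.
  by apply: le_ln1Dx; rewrite ltrN2 invf_lt1// ltr1n.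
rewrite (_ : 1 - _ = k.+1%:R / k.+2%:R); last first.
  by rewrite -[k.+2%:R]natr1; field; rewrite gt_eqF// natr1.
rewrite ln_div//.
have -> : k.+3%:R / k.+2%:R = 1 + k.+2%:R^-1 :> R.
  by rewrite -[k.+3%:R]natr1; field; rewrite gt_eqF.
have : k.+2%:R = k.+1%:R + 1 :> R by rewrite natr1.
move: (k.+2%:R^-1) (ln k.+1%:R) (ln k.+2%:R) => u v w; lra.
Qed.

(** If every value exceeded [b], so would the weighted average. Positivity of [n] excludes the empty
    minimum [+oo]. *)
Lemma bigmin_sum_le (R : realType) n (l : 'I_n -> R) (v : 'I_n -> \bar R)
    (b : R) : (forall i, v i \is a fin_num) -> (forall i, 0 < l i) ->
  (0 < n)%N -> \sum_(i < n) l i * fine (v i) <= \sum_(i < n) l i * b ->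
  (\big[mine/+oo]_(i < n) v i <= b%:E)%E.
Proof.
move=> vfin l_gt0 n_gt0; apply: contra_leT; rewrite -ltNge => bv.
have bv' i : b < fine (v i).
  rewrite -lte_fin fineK//; apply: lt_le_trans bv _.
  exact: bigmin_le_cond.
apply: ltr_sum => [|i _]; last by rewrite ltr_pM2l.
by apply/hasP; exists (Ordinal n_gt0); rewrite ?mem_index_enum.
Qed.

Lemma rate_eqO (R : realType) (c : R) :
  (fun k : nat => 2 * c
        * ((k%:R + ln k%:R + 3 / 2) / (k.+1%:R * k.+2%:R)) : R^o)
      =O_\oo (fun k : nat => c / k%:R : R^o).
Proof.
(* For k >= 1, ln k <= k gives 2(k + ln k + 3/2) <= 4k + 3 <= 7k, while (k+1)(k+2) >= k^2. *)
apply/eqO_exP; exists 7 => //; near=> k.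
have k_gt0 : (0 < k)%N by near: k; exact: nbhs_infty_gt.
have k0 : 1 <= k%:R :> R by rewrite ler1n.
have : ln k%:R <= k%:R :> R by rewrite ltW// ln_sublinear// ltr0n.
have : 0 <= ln k%:R :> R by exact: ln_ge0.
move: (ln k%:R) => l l_ge0 l_le.
pose r : R := (k%:R + l + 3 / 2) / (k.+1%:R * k.+2%:R).
have r_ge0 : 0 <= r by rewrite divr_ge0 ?mulr_ge0 ?ler0n//; lra.
have r_le : 2 * r <= 7 / k%:R.
  rewrite mulrA ler_pdivrMr ?mulr_gt0 ?ltr0n// mulrAC ler_pdivlMr; last by lra.
  by rewrite -[k.+2%:R]natr1 -[k.+1%:R]natr1; nra.
rewrite -/r -mulrA normrM [`|2|]ger0_norm// normrM [`|r|]ger0_norm//.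
rewrite normrM normfV [`|k%:R|]ger0_norm ?ler0n//.
by rewrite mulrCA [leRHS]mulrCA ler_wpM2l.
Unshelve. all: by end_near.
Qed.

Theorem theorem5p1 (R : realType) (E : finNormedModType R)
    (Q : set E) (f d : E -> \bar R) (gd g : E -> {scalar E})
    (sigma_d sigma_f M_f : R) (x0 xstar : E) (lambda beta : nat -> R)
    (phi : nat -> E -> \bar R) (z x xhat : nat -> E)
    (Hd : prox_function Q d gd sigma_d x0)
    (Hf : NSP Q d f g sigma_f)
    (Hxstar : argmin Q f xstar)
    (Hlambda : forall k, lambda k = k.+1%:R / 2)
    (Hbeta : forall k, beta k = 0)
    (Hmethod : methodN Q d gd f g sigma_f lambda beta x0 phi z x xhat)
    (Hsigma_f : 0 < sigma_f)
    (HM_f : (ereal_sup [set dual_norm (g (x k)) | k in [set: nat]]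
               <= M_f%:E)%E) :
  (classical_step lambda z x xhat ->
    forall k : nat,
      (maxe (f (xhat k) - f xstar)
            (\big[mine/+oo]_(i < k.+1) f (x i) - f xstar)
       + (sigma_f * bregman d gd (x k.+1) xstar)%:E
       <= (2 * M_f ^+ 2 / (sigma_d * sigma_f * (k + 4)%:R))%:E)%E)
  /\
  (modified_step lambda z x xhat ->
    (forall k : nat, (1 <= k)%N ->
      (f (xhat k) - f xstar + (sigma_f * bregman d gd (z k.+1) xstar)%:E
       <= (2 * M_f ^+ 2 / (sigma_d * sigma_f)
           * ((k%:R + ln k%:R + 3 / 2) / (k.+1%:R * k.+2%:R)))%:E)%E)
    /\
    (fun k : nat => 2 * M_f ^+ 2 / (sigma_d * sigma_f)
        * ((k%:R + ln k%:R + 3 / 2) / (k.+1%:R * k.+2%:R)) : R^o)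
      =O_\oo (fun k : nat => M_f ^+ 2 / (sigma_d * sigma_f * k%:R) : R^o)).
Proof.
have sd_gt0 := prox_modulus_gt0 Hd.
have lambda_gt0 k : 0 < lambda k by rewrite Hlambda divr_gt0.
have [Qs _] := Hxstar.
have fs_fin : f xstar \is a fin_num by rewrite (NSP_fin_num Hf Qs).
pose C := M_f ^+ 2 / (2 * (sigma_f * sigma_d)).
have C_ge0 : 0 <= C.
  by rewrite divr_ge0 ?sqr_ge0// !mulr_ge0// ltW.
have WE n := wsum_half n Hlambda.
split => [Hc k|Hm].
  have Qx i := classical_x_in Hmethod i Hc.
  have := phi_le_opt Hd Hf Hxstar lambda_gt0 Hbeta Hmethod Qx
    (classical_phi_ge Hd Hf lambda_gt0 Hbeta Hmethod Hsigma_f HM_f k.+1 Hc).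
  have [Qk xhat_le] := classical_xhat_le Hf lambda_gt0 Hmethod k Hc.
  rewrite sumrB.
  have err_le : \sum_(i < k.+1) (lambda i ^+ 2 * M_f ^+ 2 /
      (2 * (sigma_f * sigma_d)) / wsum lambda i.+1) <=
      C * (k.+1%:R * k.+2%:R / (k + 4)%:R).
    apply: le_trans (ler_wpM2l C_ge0 (sum_ratio_le _ k)).
    rewrite mulr_sumr; apply: ler_sum => i _.
    rewrite Hlambda WE le_eqVlt; apply/orP; left; apply/eqP.
    by rewrite /C; field; rewrite !gt_eqF ?ltr0n.
  have [-> _] := Hc k.
  set xi := bregman d gd _ _; set err := \sum_(i < k.+1) _ / _ in err_le *.
  set S := \sum_(i < k.+1) _ in xhat_le *.
  move=> main.
  (* The claimed estimate solved for the function value: both entries of the maximum reduce to a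
     bound by [b], and both follow from [S_le], through Jensen for [xhat k] and through averaging
     for the minimum. *)
  pose b := 2 * M_f ^+ 2 / (sigma_d * sigma_f * (k + 4)%:R) - sigma_f * xi
    + fine (f xstar).
  have W_gt0 : 0 < wsum lambda k.+1 by exact: wsum_gt0.
  have S_le : S <= wsum lambda k.+1 * b.
    have -> : wsum lambda k.+1 * b = C * (k.+1%:R * k.+2%:R / (k + 4)%:R)
        - wsum lambda k.+1 * sigma_f * xi + wsum lambda k.+1 * fine (f xstar).
      rewrite /b WE /C; field.
      by rewrite !gt_eqF ?ltr0n ?addn_gt0 ?orbT.
    lra.
  rewrite -leeBrDr// -EFinB ge_max; apply/andP; split; rewrite leeBlDr//.
  - rewrite (NSP_fin_num Hf Qs) (NSP_fin_num Hf Qk) -EFinD lee_fin.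
    by rewrite -(ler_pM2l W_gt0); apply: le_trans S_le.
  - rewrite (NSP_fin_num Hf Qs) -EFinD.
    apply: (@bigmin_sum_le _ _ (fun i => lambda i)) => //.
      by move=> i; rewrite (NSP_fin_num Hf (Qx i)).
    by rewrite -mulr_suml.
split; last first.
  rewrite (_ : (fun k : nat => _ / (_ * k%:R)) =
    (fun k => M_f ^+ 2 / (sigma_d * sigma_f) / k%:R)); last first.
    by apply/funext => k; rewrite invfM mulrA.
  by rewrite -[2 * _ / _]mulrA; exact: rate_eqO.
move=> k k_gt0.
have Qx i := modified_x_in Hf lambda_gt0 Hmethod i Hm.
have := phi_le_opt Hd Hf Hxstar lambda_gt0 Hbeta Hmethod Qx
  (modified_phi_ge Hd Hf lambda_gt0 Hbeta Hmethod Hsigma_f HM_f k Hm).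
rewrite (modified_xhat Hmethod k Hm).
rewrite (NSP_fin_num Hf Qs) (NSP_fin_num Hf (Qx k)) -EFinB -EFinD lee_fin.
have err_le : \sum_(i < k) (lambda i.+1 ^+ 2 * M_f ^+ 2 /
    (2 * (sigma_f * sigma_d)) / wsum lambda i.+1) <= C * (k%:R + ln k%:R + 1).
  apply: le_trans (ler_wpM2l C_ge0 (sum_harmonic_le _ k_gt0)).
  rewrite mulr_sumr; apply: ler_sum => i _.
  rewrite Hlambda WE le_eqVlt; apply/orP; left; apply/eqP.
  by rewrite /C; field; rewrite !gt_eqF ?ltr0n.
(* Here lambda_0 = S_0 = 1/2; this extra 1/2 turns the 1 of the harmonic bound into 3/2. *)
have err0 : lambda 0 ^+ 2 * M_f ^+ 2 / (2 * (sigma_f * sigma_d))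
    / wsum lambda 1 = C / 2.
  by rewrite Hlambda WE /C; field; rewrite !gt_eqF.
rewrite err0 => main.
have W_gt0 : 0 < wsum lambda k.+1 by exact: wsum_gt0.
rewrite -(ler_pM2l W_gt0) [leRHS](_ : _ = C * (k%:R + ln k%:R + 3 / 2)).
  lra.
by rewrite WE /C; field; rewrite !gt_eqF ?ltr0n.
Qed.
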